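(* Let $p$ be an odd prime. (i) Let $m,n,a$ be positive integers with $S_n(m)=a(m+1)^n$. If $p\mid m+1$, then $p-1\nmid n$. (ii) Let $m,n$ be positive integers with $S_n(m)=(m+1)^n$. If $p\mid m$, then $p-1\mid n$ and $p^2\mid m+p$. Also, if $p\mid m-\frac{p-1}{2}$, then $p-1\mid n$ and $m\equiv -\left(p+\frac12\right)\pmod{p^2}$.
   Context: For positive integers $m,n$, $S_n(m):=\sum_{j=1}^m j^n$. The equation $S_n(m)=(m+1)^n$ is the Erdős–Moser equation and $S_n(m)=a(m+1)^n$ is the generalized Erdős–Moser equation. In the congruence modulo $p^2$, $\frac12$ denotes the inverse of $2$ modulo $p^2$.
   Formalization: In the last claim of (ii) the trivial solution (m,n)=(2,1) is excluded: for p=5, p divides m-(p-1)/2=0, yet p-1=4 does not divide n=1, so that claim is false there as stated. *)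

(* Defs.v *)
From mathcomp Require Import all_boot all_order all_algebra.

Set Implicit Arguments.
Unset Strict Implicit.
Unset Printing Implicit Defensive.

Definition power_sum (n m : nat) : nat := \sum_(1 <= j < m.+1) j ^ n.

Definition erdos_moser (m n : nat) : Prop := power_sum n m = (m + 1) ^ n.

Definition gen_erdos_moser (m n a : nat) : Prop :=
  power_sum n m = a * (m + 1) ^ n.

(* The identity 1 + 2 = 3. It has to be set aside where divisibility of
   m - (p - 1) / 2 by p is assumed: for (m, n) = (2, 1) and p = 5 that difference
   is 0, but p - 1 = 4 does not divide n = 1. *)
Definition trivial_solution (m n : nat) : Prop := m = 2 /\ n = 1.

(* The difference m - (p - 1) / 2 is taken in int, as it may be negative. *)
Definition dvd_sub_half (p m : nat) : Prop :=
  (p%:Z %| (m%:Z - ((p - 1) %/ 2)%N%:Z)%R)%Z.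

(* The congruence m = -(p + 1/2) mod p ^ 2, as an equation in the ring 'Z_(p ^ 2).
   For odd p > 1 the modulus is at least 2 and 2 is a unit, so that 2^-1 is its
   inverse modulo p ^ 2. *)
Definition cong_opp_add_half (p m : nat) : Prop :=
  (m%:R = - (p%:R + 2%:R^-1) :> 'Z_(p ^ 2))%R.

(* Main.v *)
Require Import Defs.
From mathcomp Require Import all_boot all_order all_algebra.
From mathcomp Require Import finfield ring zify.

(** Write T(N) for the sum of the j ^ n over 0 <= j < N, so that S_n(m) is
    T(m + 1) when 0 < n. Modulo t, the terms of T have period t, hence
    T(q * t) = q * T(t) modulo t ([sum_powers_periodic]). Modulo p, T(p) is -1
    or 0 according as p - 1 divides n or not ([sum_powers_Fp_dvd],
    [sum_powers_Fp_ndvd]). Each part compares such a value of T with the power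
    of m + 1.

    (i) Let p - 1 divide n and let p ^ k be the exact power of p in
    m + 1 = q * p ^ k, with k > 0. The value of T(p) modulo p lifts to
    T(p ^ k) = - p ^ (k - 1) modulo p ^ k ([sum_powers_prime_power]), so that
    S_n(m) = q * T(p ^ k) = - q * p ^ (k - 1) is not 0 modulo p ^ k. But p ^ k
    divides (m + 1) ^ n.

    (ii), p dividing m = q * p. Modulo p, the equation reads q * T(p) = 1. Hence
    T(p) is not 0, p - 1 divides n, and q = -1 modulo p, that is, p ^ 2 divides
    m + p.

    (ii), m = (p - 1) / 2 modulo p. The hypothesis means that p divides
    2 m + 1 = q * p. For odd n, the terms of index j and m - j add up to a
    multiple of m, so m divides 2 S_n(m) = 2 (m + 1) ^ n and therefore divides 2;
    only 1 + 2 = 3 is left ([erdos_moser_odd_trivial]). For even n, the symmetry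
    j |-> 2 m + 1 - j preserves the n-th powers modulo p, so
    2 S_n(m) = T(2 m + 1) = q * T(p) modulo p ([sum_powers_reflect]), which gives
    q * T(p) = 2 (m + 1) ^ n. The right side is not 0, since
    2 (m + 1) = (2 m + 1) + 1. Thus p - 1 divides n, (m + 1) ^ n = 1, and
    q = -2 modulo p: p ^ 2 divides 2 m + 1 + 2 p, which is the stated congruence
    multiplied by 2. *)

Import GRing.Theory.

(** * Power sums over complete systems of residues *)

Lemma natr_Zp_eq0 (d a : nat) : 1 < d -> (a%:R == 0 :> 'Z_d)%R = (d %| a).
Proof. by move=> d_gt1; rewrite -val_eqE /= val_Zp_nat. Qed.

(** Adding the term 0 ^ n makes the index range a union of whole residue systems
    whenever the modulus divides m + 1. *)
Lemma power_sum_range0 (n m : nat) :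
  0 < n -> power_sum n m = \sum_(0 <= j < m.+1) j ^ n.
Proof. by move=> n_gt0; rewrite big_ltn // exp0n. Qed.

Lemma sum_blocks (V : nmodType) (t q : nat) (F : nat -> V) :
  (\sum_(0 <= k < q * t) F k
   = \sum_(0 <= i < q) \sum_(0 <= j < t) F (j + i * t)%N)%R.
Proof.
elim: q => [|q IHq]; first by rewrite mul0n !big_geq.
rewrite big_nat_recr //= -IHq (big_cat_nat (n := q * t)) //= ?mulSn ?leq_addl //.
by rewrite -{2}[(q * t)%N]add0n big_addn addnK.
Qed.

Section PowersInRing.

Variable R : comNzRingType.
Local Open Scope ring_scope.

Lemma sum_powers_periodic (n t q : nat) :
  t%:R = 0 :> R ->
  (\sum_(0 <= j < q * t) j ^ n)%N%:R = q%:R * (\sum_(0 <= j < t) j ^ n)%N%:R :> R.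
Proof.
move=> t0; rewrite mulr_natl 2!natr_sum sum_blocks.
rewrite -[X in _ *+ X]subn0 -sumr_const_nat; apply: eq_bigr => i _.
by apply: eq_bigr => j _; rewrite !natrX natrD natrM t0 mulr0 addr0.
Qed.

(** The binomial formula to first order. For n = 0 the factor n%:R kills the
    term whose exponent n.-1 is truncated. *)
Lemma exprD_sqr0 (x y : R) (n : nat) :
  y * y = 0 -> (x + y) ^+ n = x ^+ n + n%:R * x ^+ n.-1 * y.
Proof.
move=> yy0; elim: n => [|n IHn]; first by rewrite !expr0 !mul0r addr0.
rewrite exprS IHn; case: n {IHn} => [|n] /=.
  by rewrite !expr0 !mul0r addr0 mulr1 expr1 !mul1r.
have -> : (x + y) * (x ^+ n.+1 + n.+1%:R * x ^+ n * y)
  = x ^+ n.+2 + n.+2%:R * x ^+ n.+1 * y + n.+1%:R * x ^+ n * (y * y).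
  by rewrite -(natr1 n.+1) !exprS; move: (n.+1)%:R (x ^+ n) => c z; ring.
by rewrite yy0 mulr0 addr0.
Qed.

(** Split 0 <= k < p * t as k = j + i * t. The square of t vanishes, since t is a
    multiple of p, so (j + i * t) ^ n is j ^ n plus a first-order term linear in
    i. Summed over i < p, the first-order terms carry the factor
    0 + ... + (p - 1), which is a multiple of p because p is odd, and this kills
    them together with their factor t. *)
Lemma sum_powers_lift (n p t : nat) :
  odd p -> (p %| t)%N -> (p * t)%:R = 0 :> R ->
  (\sum_(0 <= j < p * t) j ^ n)%N%:R = p%:R * (\sum_(0 <= j < t) j ^ n)%N%:R :> R.
Proof.
move=> p_odd /dvdnP[s t_def] pt0.
have tt0 : t%:R * t%:R = 0 :> R.
  by rewrite {1}t_def natrM -mulrA -natrM pt0 mulr0.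
rewrite 2!natr_sum sum_blocks.
pose A : R := \sum_(0 <= j < t) (j ^ n)%:R.
pose B : R := \sum_(0 <= j < t) n%:R * j%:R ^+ n.-1.
have block i : \sum_(0 <= j < t) ((j + i * t) ^ n)%:R = A + i%:R * (t%:R * B) :> R.
  rewrite mulrA mulr_sumr -big_split /=; apply: eq_bigr => j _.
  rewrite !natrX natrD natrM exprD_sqr0; first by ring.
  by rewrite mulrACA tt0 mulr0.
rewrite (eq_bigr _ (fun i _ => block i)) big_split /= sumr_const_nat subn0.
rewrite -[A *+ p]mulr_natl -[RHS]addr0; congr (_ + _).
rewrite -mulr_suml -natr_sum bin2_sum bin2 mulrA -natrM.
have p1E : p.-1 = (p.-1./2).*2 by lia.
rewrite p1E -doubleMr doubleK (mulnC p) -mulnA.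
by rewrite natrM pt0 mulr0 mul0r.
Qed.

(** The reflection j |-> 2 m + 1 - j sends m < j <= 2 m onto 1 .. m, and it is
    j |-> - j in R, which even powers do not see. *)
Lemma sum_powers_reflect (m n : nat) :
  (0 < n)%N -> ~~ odd n -> m.*2.+1%:R = 0 :> R ->
  (\sum_(0 <= j < m.*2.+1) j ^ n)%N%:R = 2 * (power_sum n m)%:R :> R.
Proof.
move=> n_gt0 n_even N0.
have m_le : (m.+1 <= m.*2.+1)%N by lia.
rewrite (big_cat_nat (n := m.+1)) //= -power_sum_range0 // natrD mulr_natl mulr2n.
congr (_ + _); rewrite /power_sum -{1}[m.+1]add0n big_addn big_nat_rev big_add1 /=.
have -> : (m.*2.+1 - m.+1 = m)%N by lia.
rewrite 2!natr_sum !big_nat; apply: eq_bigr => i /andP[_ i_lt].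
rewrite add0n; have -> : (m - i.+1 + m.+1 = m.*2.+1 - i.+1)%N by lia.
rewrite !natrX natrB; last by lia.
by rewrite N0 sub0r exprNn -signr_odd (negPf n_even) mul1r.
Qed.

End PowersInRing.

(** * Power sums modulo a prime and its powers *)

Section PowersModPrime.

Variable p : nat.
Hypothesis p_prime : prime p.

Local Open Scope ring_scope.

Lemma natr_Fp_eq0 (a : nat) : (a%:R == 0 :> 'F_p) = (p %| a)%N.
Proof. by rewrite -(dvdn_pcharf (pchar_Fp p_prime)). Qed.

Lemma sum_powers_Fp (n : nat) :
  (\sum_(0 <= j < p) j ^ n)%N%:R = \sum_(x : 'F_p) x ^+ n :> 'F_p.
Proof.
rewrite natr_sum -[X in \sum_(0 <= _ < X) _](Fp_cast p_prime) big_mkord.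
apply: eq_bigr => x _; rewrite natrX; congr (_ ^+ _).
exact: natr_Zp.
Qed.

Lemma fermat_Fp (n : nat) (x : 'F_p) :
  (p - 1 %| n)%N -> x != 0 -> x ^+ n = 1.
Proof.
move=> /dvdnP[k ->] x_nz; rewrite mulnC exprM.
suff -> : x ^+ (p - 1) = 1 by rewrite expr1n.
apply: (mulfI x_nz); rewrite mulr1 -exprS subn1 prednK ?prime_gt0 //.
by have := expf_card x; rewrite card_Fp.
Qed.

Lemma sum_powers_Fp_dvd (n : nat) :
  (0 < n)%N -> (p - 1 %| n)%N ->
  (\sum_(0 <= j < p) j ^ n)%N%:R = -1 :> 'F_p.
Proof.
move=> n_gt0 dvd_n; rewrite sum_powers_Fp (bigD1 0) //= expr0n gtn_eqF // add0r.
rewrite (eq_bigr (fun=> 1)); last by move=> x; apply: fermat_Fp.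
rewrite sumr_const cardC1 card_Fp // -subn1 natrB ?prime_gt0 //.
by rewrite pchar_Fp_0 // sub0r.
Qed.

(** With r the remainder of n modulo p - 1, x ^ n = x ^ r for x != 0. Were it
    always 1, 'X^r - 1 with 0 < r < p - 1 would have p - 1 roots. *)
Lemma exists_power_neq1 (n : nat) :
  ~~ (p - 1 %| n)%N -> exists2 x : 'F_p, x != 0 & x ^+ n != 1.
Proof.
move=> ndvd_n; have p1_gt0 : (0 < p - 1)%N by rewrite subn_gt0 prime_gt1.
pose r := (n %% (p - 1))%N.
have r_gt0 : (0 < r)%N by rewrite lt0n.
have [/existsP[x /andP[x_nz xr]]|all1] :=
  boolP [exists x : 'F_p, (x != 0) && (x ^+ r != 1)].
  exists x => //; rewrite (divn_eq n (p - 1)) exprD fermat_Fp ?dvdn_mull //.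
  by rewrite mul1r.
have : (size (enum (predC1 (0%R : 'F_p))) <= r)%N.
  apply: max_unity_roots; rewrite ?enum_uniq //.
  apply/allP => x; rewrite mem_enum => x_nz; rewrite unity_rootE.
  by apply: contraR all1 => xr; apply/existsP; exists x; apply/andP.
by rewrite -cardE cardC1 card_Fp // -subn1 leqNgt ltn_mod p1_gt0.
Qed.

(** Multiplication by a permutes 'F_p, so the sum S satisfies a ^ n * S = S; choose
    a with a ^ n != 1. *)
Lemma sum_powers_Fp_ndvd (n : nat) :
  ~~ (p - 1 %| n)%N -> (\sum_(0 <= j < p) j ^ n)%N%:R = 0 :> 'F_p.
Proof.
move=> /exists_power_neq1[a a_nz an_neq1]; rewrite sum_powers_Fp.
set S := \sum_x _.
have : (a ^+ n - 1) * S = 0.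
  rewrite mulrBl mul1r; apply/eqP; rewrite subr_eq0; apply/eqP.
  rewrite [RHS](reindex_inj (mulfI a_nz)) mulr_sumr.
  by apply: eq_bigr => x _; rewrite exprMn.
by move/eqP; rewrite mulf_eq0 subr_eq0 (negPf an_neq1) => /eqP.
Qed.

(** Induction on k: passing from p ^ k.+1 to p ^ k.+2 multiplies the sum by p,
    modulo p ^ k.+2, so that the congruence modulo p ^ k.+1 is just multiplied
    through by p. *)
Lemma sum_powers_prime_power (n k : nat) :
  odd p -> (0 < n)%N -> (p - 1 %| n)%N ->
  (p ^ k.+1 %| \sum_(0 <= j < p ^ k.+1) j ^ n + p ^ k)%N.
Proof.
move=> p_odd n_gt0 dvd_n; elim: k => [|k IHk].
  rewrite expn0 expn1 -natr_Fp_eq0 natrD sum_powers_Fp_dvd //.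
  by rewrite addNr.
have pk_gt1 : (1 < p ^ k.+2)%N by rewrite -(exp1n k.+2) ltn_exp2r ?prime_gt1.
rewrite -natr_Zp_eq0 // natrD [in X in \sum_(0 <= j < X) _]expnS.
rewrite sum_powers_lift //; last 2 first.
- by rewrite expnS dvdn_mulr.
- by apply/eqP; rewrite -expnS natr_Zp_eq0.
rewrite -natrM -natrD natr_Zp_eq0 // [(p ^ k.+2)%N]expnS [X in (_ + X)%N]expnS.
by rewrite -mulnDr dvdn_pmul2l ?prime_gt0.
Qed.

(** The sum is - q * p ^ k modulo p ^ k.+1. *)
Lemma sum_powers_prime_power_mul (n k q : nat) :
  odd p -> (0 < n)%N -> (p - 1 %| n)%N ->
  (p ^ k.+1 %| \sum_(0 <= j < q * p ^ k.+1) j ^ n)%N -> (p %| q)%N.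
Proof.
move=> p_odd n_gt0 dvd_n.
have pk_gt1 : (1 < p ^ k.+1)%N by rewrite -(exp1n k.+1) ltn_exp2r ?prime_gt1.
rewrite -natr_Zp_eq0 // sum_powers_periodic; last first.
  by apply/eqP; rewrite natr_Zp_eq0.
rewrite -natrM natr_Zp_eq0 // => dvd_qS.
have := dvdn_mull q (sum_powers_prime_power n k p_odd n_gt0 dvd_n).
rewrite mulnDr dvdn_addr // expnS dvdn_pmul2r //.
by rewrite expn_gt0 prime_gt0.
Qed.

End PowersModPrime.

(** * Solutions with p dividing m + 1 *)

Lemma gen_erdos_moser_ndvd (p m n a : nat) :
  prime p -> odd p -> 0 < n -> gen_erdos_moser m n a ->
  p %| m + 1 -> ~~ (p - 1 %| n).
Proof.
move=> p_prime p_odd n_gt0; rewrite /gen_erdos_moser power_sum_range0 // => eqn.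
move=> p_dvd; apply/negP => dvd_n.
have m1_gt0 : 0 < m.+1 by [].
have [q co_pq m1E] := pfactor_coprime p_prime m1_gt0.
have k_gt0 : 0 < logn p m.+1.
  by rewrite logn_gt0 mem_primes p_prime /= -(addn1 m) p_dvd.
case: (logn p m.+1) k_gt0 m1E => // k _ m1E.
move: co_pq; rewrite prime_coprime // => /negP; apply.
(* p ^ k.+1, the exact power of p in m + 1, divides (m + 1) ^ n as 0 < n. *)
apply: (@sum_powers_prime_power_mul p p_prime n k) => //.
by rewrite -m1E eqn dvdn_mull // addn1 dvdn_exp // m1E dvdn_mull.
Qed.

(** * Odd exponents *)

Lemma dvd_odd_powersD (j k n : nat) : odd n -> j + k %| j ^ n + k ^ n.
Proof.
move=> n_odd; rewrite -(odd_double_half n) n_odd add1n.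
elim: n./2 => [|h IHh]; first by rewrite double0 !expn1.
rewrite doubleS.
(* j^(n+2) + k^(n+2) + j k (j^n + k^n) = (j + k) (j^(n+1) + k^(n+1)) *)
rewrite -(dvdn_addl _ (dvdn_mull (j * k) IHh)).
apply/dvdnP; exists (j ^ h.*2.+2 + k ^ h.*2.+2); rewrite !expnS; ring.
Qed.

(** Pair the terms of index j and m - j. *)
Lemma power_sum_odd_dvd (m n : nat) : odd n -> m %| 2 * power_sum n m.
Proof.
move=> n_odd; rewrite power_sum_range0 ?odd_gt0 // mul2n -addnn.
rewrite [X in _ + X]big_nat_rev -big_split /= big_nat.
apply: dvdn_sum => j /andP[_ j_lt]; rewrite add0n subSS.
by rewrite -{1}(subnKC (_ : j <= m)) // dvd_odd_powersD.
Qed.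

(** Since m divides 2 * (m + 1) ^ n and is coprime to m + 1, it divides 2. For
    m = 1 the equation is 1 = 2 ^ n; for m = 2 it is 1 + 2 ^ n = 3 ^ n, where the
    right side is too large as soon as n > 1. *)
Lemma erdos_moser_odd_trivial (m n : nat) :
  0 < m -> odd n -> erdos_moser m n -> trivial_solution m n.
Proof.
move=> m_gt0 n_odd eqn; have n_gt0 := odd_gt0 n_odd.
have m_dvd2 : m %| 2.
  have := power_sum_odd_dvd m n n_odd; rewrite (eqn : _ = _) Gauss_dvdl //.
  by rewrite coprimeXr // addn1 coprimenS.
have m_le2 : m <= 2 by apply: dvdn_leq.
case: m m_gt0 eqn m_le2 {m_dvd2} => [|[|[|m]]] // _.
  rewrite /erdos_moser /power_sum big_nat1 exp1n => eqn.
  by have := ltn_expl n (isT : 1 < 2); rewrite -[2]/(1 + 1) -eqn; lia.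
rewrite /erdos_moser /power_sum big_ltn // big_nat1 exp1n => eqn _; split=> //.
case: n n_odd n_gt0 eqn => [|[|n]] // _ _ eqn.
have : 2 ^ n.+1 < 3 ^ n.+1 by rewrite ltn_exp2r.
by move: eqn; rewrite -[2 + 1]/3 !(expnS _ n.+1); lia.
Qed.

(** * Solutions with p dividing m or 2 m + 1 *)

(** Modulo p the equation reads q * T = 1, where m = q * p and T is the sum of the
    n-th powers over 'F_p; so T = -1 and q = -1. *)
Lemma erdos_moser_dvd (p m n : nat) :
  prime p -> 0 < n -> erdos_moser m n -> p %| m ->
  p - 1 %| n /\ p ^ 2 %| m + p.
Proof.
move=> p_prime n_gt0 eqn p_dvd; have [q mE] := dvdnP p_dvd.
have p0 : (p%:R = 0 :> 'F_p)%R by exact: pchar_Fp_0.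
have m0 : (m%:R = 0 :> 'F_p)%R by rewrite mE natrM p0 mulr0.
have : ((power_sum n m)%:R = 1 :> 'F_p)%R.
  by rewrite (eqn : _ = _) natrX natrD m0 add0r expr1n.
rewrite power_sum_range0 // big_nat_recr //= natrD natrX m0 expr0n gtn_eqF // addr0.
rewrite mE (sum_powers_periodic _ n p q p0).
have [dvd_n|ndvd_n] := boolP (p - 1 %| n); last first.
  by rewrite sum_powers_Fp_ndvd // mulr0 => /esym/eqP; rewrite oner_eq0.
rewrite sum_powers_Fp_dvd // mulrN1 => qE; split=> //.
rewrite -[X in _ + X]mul1n -mulnDl dvdn_pmul2r ?prime_gt0 //.
by rewrite -natr_Fp_eq0 // natrD addr_eq0 -eqr_oppLR qE.
Qed.

(** Modulo p the equation, doubled, reads q * T = 2 * (m + 1) ^ n with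
    2 m + 1 = q * p and T the sum of the n-th powers over 'F_p. The right side is
    not 0, so T = -1; then p - 1 divides n, the power is 1, and q = -2. *)
Lemma erdos_moser_even_dvd_half (p m n : nat) :
  prime p -> odd p -> 0 < n -> ~~ odd n -> erdos_moser m n ->
  p %| m.*2.+1 -> p - 1 %| n /\ p ^ 2 %| m.*2.+1 + p.*2.
Proof.
move=> p_prime p_odd n_gt0 n_even eqn p_dvd; have [q mE] := dvdnP p_dvd.
have p0 : (p%:R = 0 :> 'F_p)%R by exact: pchar_Fp_0.
have N0 : (m.*2.+1%:R = 0 :> 'F_p)%R by rewrite mE natrM p0 mulr0.
have two_nz : (2 != 0 :> 'F_p)%R.
  rewrite natr_Fp_eq0 // dvdn_prime2 //; apply: contraL p_odd => /eqP ->.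
  by [].
have m1_nz : ((m + 1)%:R != 0 :> 'F_p)%R.
  rewrite natr_Fp_eq0 //; apply/negP => p_dvd1.
  have := dvdn_sub (dvdn_mull 2 p_dvd1) p_dvd.
  have -> : 2 * (m + 1) - m.*2.+1 = 1 by lia.
  by rewrite dvdn1 => /eqP p1; rewrite p1 in p_prime.
have := sum_powers_reflect _ m n n_gt0 n_even N0.
rewrite mE (sum_powers_periodic _ n p q p0) (eqn : _ = _) natrX.
have [dvd_n|ndvd_n] := boolP (p - 1 %| n); last first.
  rewrite sum_powers_Fp_ndvd // mulr0 => /esym/eqP.
  by rewrite mulf_eq0 (negPf two_nz) expf_eq0 (negPf m1_nz) andbF.
rewrite sum_powers_Fp_dvd // fermat_Fp // mulrN1 mulr1 => qE; split=> //.
rewrite -mul2n -mulnDl dvdn_pmul2r ?prime_gt0 //.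
by rewrite -natr_Fp_eq0 // natrD addr_eq0 -eqr_oppLR qE.
Qed.

(** 2 m + 1 = 2 (m - (p - 1) / 2) + p. *)
Lemma dvd_sub_half_double (p m : nat) :
  odd p -> dvd_sub_half p m -> p %| m.*2.+1.
Proof.
rewrite /dvd_sub_half => p_odd half_m.
suff : (p%:Z %| (m.*2.+1)%:Z)%Z by [].
have -> : ((m.*2.+1)%:Z = 2 * (m%:Z - ((p - 1) %/ 2)%N%:Z) + p%:Z)%R by lia.
by rewrite rpredD // dvdz_mull.
Qed.

(** Divide 2 m = - (2 p + 1) by the unit 2. *)
Lemma cong_opp_add_half_dvd (p m : nat) :
  1 < p -> odd p -> p ^ 2 %| m.*2.+1 + p.*2 -> cong_opp_add_half p m.
Proof.
move=> p_gt1 p_odd dvd_m.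
have p2_gt1 : 1 < p ^ 2 by rewrite -(exp1n 2) ltn_exp2r.
have unit2 : (2 : 'Z_(p ^ 2))%R \is a GRing.unit.
  by rewrite unitZpE // coprimeXl // coprime_sym coprime2n.
apply: (mulrI unit2); rewrite mulrN mulrDr divrr //; apply/eqP.
rewrite -addr_eq0 -!natrM addrA -natrD natr1 natr_Zp_eq0 //.
by rewrite -addnS !mul2n addnC -addSnnS addnC in dvd_m *.
Qed.

Theorem theorem6 (p : nat) (p_prime : prime p) (p_odd : odd p) :
  (forall m n a : nat, 0 < m -> 0 < n -> 0 < a ->
     gen_erdos_moser m n a ->
     p %| m + 1 -> ~~ (p - 1 %| n))
  /\
  (forall m n : nat, 0 < m -> 0 < n ->
     erdos_moser m n ->
     (p %| m -> p - 1 %| n /\ p ^ 2 %| m + p)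
     /\
     (~ trivial_solution m n ->
      dvd_sub_half p m -> p - 1 %| n /\ cong_opp_add_half p m)).
Proof.
split=> [m n a _ n_gt0 _|m n m_gt0 n_gt0 eqn]; first exact: gen_erdos_moser_ndvd.
split=> [|ntriv half_m]; first exact: erdos_moser_dvd.
have n_even : ~~ odd n.
  by apply/negP => n_odd; apply: ntriv; apply: erdos_moser_odd_trivial.
have [//|dvd_n dvd_m] := erdos_moser_even_dvd_half p m n p_prime p_odd n_gt0 n_even eqn.
  exact: dvd_sub_half_double.
by split=> //; apply: cong_opp_add_half_dvd; rewrite ?prime_gt1.
Qed.
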